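(* Let $f$ belong to the Laguerre-Pólya class and satisfy $f''-2af'+bf=0$, let $t=f'/f$ and $\Delta(x)=b(x)-a^2(x)$, and suppose that $a(x)$ intersects the branch $B_i$ of $t$ at $x=c_i$ (that is, $x_i<c_i<x_{i+1}$ and $a(c_i)=t(c_i)$). Let $J$ be the region defined by $\Delta(x)>0$. Then $c_i\in J$, and moreover $$x_i<c_i-\frac{1}{\sqrt{\Delta(c_i)}},\qquad x_{i+1}>c_i+\frac{1}{\sqrt{\Delta(c_i)}}.$$ In particular, if $a(x)$ intersects $B_0$ (the branch to the left of the least zero $x_1$), then $$x_1>\min_{x\in J}\left\{x+\frac{1}{\sqrt{\Delta(x)}}\right\},$$ and if $a(x)$ intersects $B_k$ (the branch to the right of the largest zero $x_k$), then $$x_k<\max_{x\in J}\left\{x-\frac{1}{\sqrt{\Delta(x)}}\right\}.$$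
   Context: The Laguerre-Pólya class consists of real polynomials having only real zeros and of real entire functions having a representation of the form $c\,x^m e^{-\alpha x^2+\beta x}\prod_{i=1}^{\infty}\left(1-\frac{x}{x_i}\right)e^{x/x_i}$, where $c,\beta,x_i$ are real, $\alpha\ge 0$, $m$ is a nonnegative integer and $\sum x_i^{-2}<\infty$. The function $f$ is not identically zero. The functions $a,b$ are real-valued functions of a real variable (possibly undefined at some points), and the equation $f''-2af'+bf=0$ holds at all real points where $a,b$ are defined. The logarithmic derivative is $t(x)=f'(x)/f(x)$ and the discriminant is $\Delta(x)=b(x)-a^2(x)$. If $f$ is a polynomial with $k$ distinct real zeros $x_1<x_2<\dots<x_k$ (listed without multiplicity), put formally $x_0=-\infty$, $x_{k+1}=\infty$. Then $t$ consists of $k+1$ decreasing branches $B_0,B_1,\dots,B_k$, where $B_i$ is the restriction of $t$ to $(x_i,x_{i+1})$. The same notation, with the obvious modification, is used for entire functions, where the increasing sequence of distinct zeros $\{x_i\}$ and the sequence of branches $\{B_i\}$ may be infinite on one or both sides; $B_0$ (resp. $B_k$) in the last part refers to the case where there is a least zero $x_1$ (resp. a largest zero $x_k$). Inequalities involving $x_i=-\infty$ or $x_{i+1}=+\infty$ are vacuous. A minimum (maximum) that is not attained is read as an infimum (supremum).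
   Formalization: The formal theorem assumes in addition that f is not of the form (px+q)e^{βx}; for such f the claim fails at every intersection (e.g. f=x, a=1, b=2/x, c=1 gives equality x_1 = c − 1/√Δ(c); for f=Ce^{βx}, Δ(c)=0). *)

(* Defs.v *)
From mathcomp Require Import all_boot all_order all_algebra.
From mathcomp Require Import complex.
From mathcomp Require Import all_classical all_reals all_analysis.
Set Implicit Arguments.
Unset Strict Implicit.
Unset Printing Implicit Defensive.
Import Order.TTheory GRing.Theory Num.Theory.
Import numFieldNormedType.Exports.
Local Open Scope classical_set_scope.
Local Open Scope ring_scope.

Definition real_rooted (R : realType) (p : {poly R}) : Prop :=
  forall w : R[i], root (map_poly (real_complex R) p) w -> complex.Im w = 0.

(* Functions are considered on the real line only. The product runs over the
   indices selected by [I]: [I = xpredT] gives a genuinely infinite product,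
   while a finite or empty [I] gives the usual finite (possibly empty)
   products, as in exp (- x ^ 2) or x * exp x. *)
Definition laguerre_polya (R : realType) (f : R -> R) : Prop :=
  (exists2 p : {poly R}, real_rooted p & forall x, f x = p.[x])
  \/
  (exists (c alpha beta : R) (m : nat) (I : pred nat) (z : nat -> R),
    [/\ 0 <= alpha,
        forall i, I i -> z i != 0,
        cvgn (fun n : nat => \sum_(0 <= i < n | I i) (z i) ^- 2 : R) &
        forall x : R,
          (fun n : nat => c * x ^+ m * expR (- alpha * x ^+ 2 + beta * x) *
             \prod_(0 <= i < n | I i) ((1 - x / z i) * expR (x / z i)))
          @ \oo --> f x]).

Definition logder (R : realType) (f : R -> R) (x : R) : R := derive1 f x / f x.

Definition discr (R : realType) (a b : R -> R) (x : R) : R := b x - a x ^+ 2.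

(* The coefficients a and b are partial functions: [D] is the set of points
   where both are defined, and their values outside [D] are never used. *)
Definition solves_ode (R : realType) (D : set R) (a b f : R -> R) : Prop :=
  forall x, D x -> derive1n 2 f x - 2 * a x * derive1 f x + b x * f x = 0.

Definition regionJ (R : realType) (D : set R) (a b : R -> R) : set R :=
  [set x | D x /\ 0 < discr a b x].

(* ]l, r[ is one of the intervals cut out by the zeros of f: l and r are
   consecutive distinct zeros, l = -oo if there is no zero to the left and
   r = +oo if there is no zero to the right. *)
Definition branch_interval (R : realType) (f : R -> R) (l r : \bar R) : Prop :=
  [/\ l = -oo%E \/ (exists2 x, l = x%:E & f x = 0),
      r = +oo%E \/ (exists2 x, r = x%:E & f x = 0),
      (l < r)%E &
      forall x : R, (l < x%:E)%E -> (x%:E < r)%E -> f x != 0].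

Definition meets_branch (R : realType) (D : set R) (a f : R -> R)
    (l r : \bar R) (c : R) : Prop :=
  [/\ branch_interval f l r, (l < c%:E)%E, (c%:E < r)%E, D c &
      a c = logder f c].

(* For f = C exp (beta x) the logarithmic derivative is constant (not
   decreasing) and discr vanishes wherever a meets it; for
   f = C (x - x1) exp (beta x), discr = (x - x1) ^- 2 wherever a meets the
   logarithmic derivative, so the strict bounds below become equalities. *)
Definition affine_times_exp (R : realType) (f : R -> R) : Prop :=
  exists p q beta : R, forall x, f x = (p * x + q) * expR (beta * x).

(* Main.v *)
Require Import Defs.
From mathcomp Require Import all_boot all_order all_algebra.
From mathcomp Require Import complex ring lra.
From mathcomp Require Import all_classical all_reals all_analysis.
Set Implicit Arguments.
Unset Strict Implicit.
Unset Printing Implicit Defensive.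
Import Order.TTheory GRing.Theory Num.Theory.
Import numFieldNormedType.Exports.
Local Open Scope classical_set_scope.
Local Open Scope ring_scope.

(** Where a meets t = f'/f the equation f'' - 2af' + bf = 0 turns into
    b - a^2 = - t', because t' = f''/f - t^2.  So the discriminant at c is the
    curvature - (log |f|)'' (c), and for a function of the Laguerre-Polya class
    with exponent alpha and zeros z_i (repeated with multiplicity) that is
      2 alpha + sum_i (c - z_i)^-2.
    Each zero z contributes (c - z)^-2, hence |c - z| >= 1 / sqrt (discr c).
    Equality would force alpha = 0 and a single zero, that is, f = (affine
    function) * exp; this is the excluded case.  The bounds on the extreme
    zeros follow by evaluating the infimum or supremum at c.

    The analytic work is to differentiate f twice when f is only known as a
    pointwise limit of products.  Both forms of the class are put in one shape
    ([gauss_limit]): f is the limit of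
      F_n(x) = C_n exp (- alpha x^2 + beta_n x) prod_(r in Z_n) (x - r)
    over growing finite lists Z_n of real zeros, the exponential convergence
    factors being absorbed in C_n and beta_n.  No uniform convergence and no
    logarithm is used.  The inequalities exp (u - 2 u^2) <= 1 + u <= exp u
    bound F_n(x + h) - F_n(x) - h F_n'(x) by a constant times |F_n(x)| h^2
    ([gauss_poly_shift_bound]); such a bound passes to the pointwise limit
    ([limit_shift_bound]), and it implies f' = f t off the Z_n.  A similar
    bound for the partial fractions gives t' ([limit_logder_is_derive]), and
    [discr_limit_curv] combines the two with the equation.

    It remains to know that an endpoint of the branch, where f vanishes, is in
    some Z_n.  A convergent product of nonzero factors could a priori vanish,
    but the same bound shows that f would then vanish on a neighbourhood of
    the endpoint ([limit_zero_near]), and f has no zero inside the branch. *)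

(** * Second-order estimates for finite products *)

Definition gauss_poly {R : realType} (al C be : R) (s : seq R) (x : R) : R :=
  C * expR (- al * x ^+ 2 + be * x) * \prod_(r <- s) (x - r).

Definition sum_inv {R : realType} (s : seq R) (x : R) : R :=
  \sum_(r <- s) (x - r)^-1.

Definition sum_inv2 {R : realType} (s : seq R) (x : R) : R :=
  \sum_(r <- s) (x - r) ^- 2.

Lemma sum_inv2_ge0 {R : realType} (s : seq R) (x : R) : 0 <= sum_inv2 s x.
Proof. by apply: sumr_ge0 => r _; rewrite exprnN invr_ge0 sqr_ge0. Qed.

Lemma sum_inv2_gt0 {R : realType} (s : seq R) (x : R) :
  x \notin s -> (0 < size s)%N -> 0 < sum_inv2 s x.
Proof.
case: s => //= r s; rewrite inE negb_or => /andP[xr _] _.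
rewrite /sum_inv2 big_cons ltr_wpDr ?sum_inv2_ge0// invr_gt0.
by rewrite exprn_even_gt0 //= subr_eq0.
Qed.

(** A quadratic error bound is a closed condition on g and d, so unlike
    differentiability it survives pointwise limits; every derivative of a limit
    below is obtained from it. *)
Lemma is_derive_quadratic {R : realType} (g : R -> R) (x d K e : R) :
  0 < e -> (forall h, `|h| <= e -> `|g (x + h) - g x - h * d| <= K * h ^+ 2) ->
  is_derive x 1 g d.
Proof.
move=> e0 H.
have K0 : 0 <= K.
  have := H e; rewrite (ger0_norm (ltW e0)) => /(_ (lexx _)) /(le_trans (normr_ge0 _)).
  by rewrite pmulr_lge0// exprn_gt0.
have K1 : 0 < K + 1 by lra.
have L : h^-1 *: ((g \o shift x) (h *: 1) - g x) @[h --> 0^'] --> d.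
  apply/cvgrPdist_le => eps eps0.
  near=> h.
  have h0 : h != 0 by near: h; exact: nbhs_dnbhs_neq.
  have he : `|h| <= e by near: h; apply: dnbhs0_le.
  have hK : `|h| <= eps / (K + 1).
    by near: h; apply: dnbhs0_le; rewrite divr_gt0.
  have := H h he; rewrite /= /shift /= /GRing.scale /= mulr1 [h + x]addrC => H'.
  have -> : d - h^-1 * (g (x + h) - g x) = - h^-1 * (g (x + h) - g x - h * d).
    by field.
  rewrite normrM normrN normfV ler_pdivrMl ?normr_gt0//.
  apply: (le_trans H'); rewrite -[h ^+ 2]ger0_norm ?sqr_ge0// normrX expr2 mulrCA.
  apply: ler_wpM2l => //.
  rewrite ler_pdivlMr// in hK.
  by apply: le_trans hK; rewrite mulrC; apply: ler_wpM2l => //; rewrite lerDl.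
apply: DeriveDef; first by apply/cvg_ex; exists d.
exact: cvg_lim L.
Unshelve. all: by end_near. Qed.

(** From exp (- v) <= 1 / (1 + v) with v = 2 u^2 - u: the coefficient 2, where
    any constant above 1/2 would do for small u, makes the remaining inequality
    (1 + u) (1 - u + 2 u^2) = 1 + u^2 (1 + 2 u) >= 1 hold down to u = -1/2. *)
Lemma expR_le_oneD {R : realType} (u : R) : `|u| <= 2^-1 ->
  expR (u - 2 * u ^+ 2) <= 1 + u.
Proof.
rewrite ler_norml => /andP[u1 u2].
rewrite -[_ - _]opprK expRN.
have q0 : 0 < 1 + (- (u - 2 * u ^+ 2)).
  by rewrite expr2; nra.
have : 1 + (- (u - 2 * u ^+ 2)) <= expR (- (u - 2 * u ^+ 2)) by exact: expR_ge1Dx.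
move=> H; rewrite -[leLHS]mul1r ler_pdivrMr ?expR_gt0//.
have u10 : 0 <= 1 + u by lra.
apply: le_trans (ler_wpM2l u10 H).
have -> : (1 + u) * (1 + - (u - 2 * u ^+ 2)) = 1 + u ^+ 2 * (1 + 2 * u) by ring.
by rewrite lerDl mulr_ge0 ?sqr_ge0//; lra.
Qed.

Lemma expR_bound_quadratic {R : realType} (w v rho : R) : `|w| <= 2^-1 -> 0 <= v ->
  expR (w - v) <= rho -> rho <= expR w -> `|rho - 1 - w| <= 2 * w ^+ 2 + v.
Proof.
move=> w1 v0 H1 H2.
have H3 : expR w <= 1 + w + 2 * w ^+ 2.
  (* exp w <= 1 / (1 - w), and (1 + w + 2 w^2) (1 - w) = 1 + w^2 (1 - 2 w). *)
  move: w1; rewrite ler_norml => /andP[wl wu].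
  have e2 : expR w * expR (- w) = 1 by rewrite -expRD subrr expR0.
  have : expR w * (1 - w) <= 1 by rewrite -[leRHS]e2; apply: ler_wpM2l; rewrite ?expR_ge0 ?expR_ge1Dx.
  have c0 : 0 < 1 - w by lra.
  rewrite -ler_pdivlMr// => /le_trans; apply.
  rewrite ler_pdivrMr// .
  have -> : (1 + w + 2 * w ^+ 2) * (1 - w) = 1 + w ^+ 2 * (1 - 2 * w) by ring.
  by rewrite lerDl mulr_ge0 ?sqr_ge0//; lra.
have H4 : 1 + (w - v) <= expR (w - v) by exact: expR_ge1Dx.
have := sqr_ge0 w.
by rewrite ler_norml => ?; apply/andP; split; lra.
Qed.

Lemma prod_oneD_bounds {R : realType} (s : seq R) (u : R -> R) :
  (forall r, r \in s -> `|u r| <= 2^-1) ->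
  expR (\sum_(r <- s) u r - 2 * \sum_(r <- s) u r ^+ 2) <= \prod_(r <- s) (1 + u r)
    <= expR (\sum_(r <- s) u r).
Proof.
move=> H; rewrite mulr_sumr -sumrB !expR_sum.
rewrite 3!big_seq.
apply/andP; split; apply: ler_prod => r rs.
  by rewrite expR_ge0 expR_le_oneD ?H.
rewrite expR_ge1Dx andbT.
by have := H _ rs; rewrite ler_norml => /andP[]; lra.
Qed.

Lemma gauss_poly_shift {R : realType} (al C be : R) (s : seq R) (x h : R) :
  (forall r, r \in s -> x != r) ->
  gauss_poly al C be s (x + h) = gauss_poly al C be s x *
    (expR (- al * h ^+ 2 + h * (be - 2 * al * x))
       * \prod_(r <- s) (1 + h / (x - r))).
Proof.
move=> xs; rewrite /gauss_poly.
have -> : \prod_(r <- s) (x + h - r)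
    = \prod_(r <- s) (x - r) * \prod_(r <- s) (1 + h / (x - r)).
  rewrite -big_split /= 2!big_seq; apply: eq_bigr => r rs.
  by have := xs _ rs; rewrite -subr_eq0 => ?; field.
have -> : expR (- al * (x + h) ^+ 2 + be * (x + h)) =
    expR (- al * x ^+ 2 + be * x) * expR (- al * h ^+ 2 + h * (be - 2 * al * x)).
  by rewrite -expRD; congr expR; ring.
by ring.
Qed.

(** S is the logarithmic derivative of the product at x.  Relative to its value
    at x, the value at x + h lies between exp (h S - h^2 T) and exp (h S), with
    T = al + 2 sum_inv2.  Since the constant only depends on S, al and
    sum_inv2 s x, and not on the number of factors, the estimate is stable when
    s grows. *)
Lemma gauss_poly_shift_bound {R : realType} (al C be : R) (s : seq R) (x h : R) :
  0 <= al -> (forall r, r \in s -> x != r) ->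
  (forall r, r \in s -> 2 * `|h| <= `|x - r|) ->
  let S := be + sum_inv s x - 2 * al * x in
  2 * `|h * S| <= 1 ->
  `|gauss_poly al C be s (x + h) - gauss_poly al C be s x
     - h * (gauss_poly al C be s x * S)|
  <= `|gauss_poly al C be s x| *
     ((2 * S ^+ 2 + al + 2 * sum_inv2 s x) * h ^+ 2).
Proof.
move=> al0 xs hs S hS.
rewrite gauss_poly_shift//; set rho := (X in _ * X - _ - _).
set F := gauss_poly _ _ _ _ _.
have -> : F * rho - F - h * (F * S) = F * (rho - 1 - h * S) by ring.
rewrite normrM ler_wpM2l//.
have -> : (2 * S ^+ 2 + al + 2 * sum_inv2 s x) * h ^+ 2 =
  2 * (h * S) ^+ 2 + (al + 2 * sum_inv2 s x) * h ^+ 2 by ring.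
have q0 := sum_inv2_ge0 s x.
have /andP[l u] : expR (\sum_(r <- s) (h / (x - r)) - 2 * \sum_(r <- s) (h / (x - r)) ^+ 2)
   <= \prod_(r <- s) (1 + h / (x - r)) <= expR (\sum_(r <- s) (h / (x - r))).
  apply: (@prod_oneD_bounds R s (fun r => h / (x - r))) => r rs.
  have d0 : 0 < `|x - r| by rewrite normr_gt0 subr_eq0 xs.
  by rewrite normrM normfV ler_pdivrMr// -ler_pdivrMl ?invr_gt0// invrK hs.
have e1 : \sum_(r <- s) (h / (x - r)) = h * sum_inv s x by rewrite /sum_inv mulr_sumr.
have e2 : \sum_(r <- s) (h / (x - r)) ^+ 2 = h ^+ 2 * sum_inv2 s x.
  by rewrite /sum_inv2 mulr_sumr; apply: eq_bigr => r _; rewrite exprMn exprVn.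
rewrite e1 e2 in l; rewrite e1 in u.
apply: expR_bound_quadratic.
- lra.
- by rewrite mulr_ge0 ?sqr_ge0// addr_ge0// mulr_ge0.
- apply: le_trans (ler_wpM2l (expR_ge0 _) l).
  by rewrite -expRD ler_expR /S le_eqVlt; apply/orP; left; apply/eqP; ring.
- apply: le_trans (ler_wpM2l (expR_ge0 _) u) _.
  rewrite -expRD ler_expR /S -subr_ge0.
  have -> : h * (be + sum_inv s x - 2 * al * x) -
     (- al * h ^+ 2 + h * (be - 2 * al * x) + h * sum_inv s x) = al * h ^+ 2 by ring.
  by rewrite mulr_ge0 ?sqr_ge0.
Qed.

(** * Pointwise limits of such products *)

(** A common form of the polynomials and of the Hadamard products of the
    Laguerre-Polya class.  The lists grow by appending, so that the sums of
    (x - r)^-2 are monotone in n and a zero of one F_n is a zero of f.  The two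
    convergent sums are those of the first two logarithmic derivatives. *)
Record gauss_limit (R : realType) (f : R -> R) (al : R) (C be : nat -> R)
    (Z : nat -> seq R) : Prop := GaussLimit {
  gl_ge0 : 0 <= al;
  gl_prefix : forall n m, (n <= m)%N -> prefix (Z n) (Z m);
  gl_cvg : forall x, gauss_poly al (C n) (be n) (Z n) x @[n --> \oo] --> f x;
  gl_inv : forall x, (forall n, x \notin Z n) ->
    cvgn (fun n => be n + sum_inv (Z n) x);
  gl_inv2 : forall x, (forall n, x \notin Z n) ->
    cvgn (fun n => sum_inv2 (Z n) x) }.

Definition limit_logder (R : realType) (al : R) (be : nat -> R)
    (Z : nat -> seq R) (x : R) : R :=
  limn (fun n => be n + sum_inv (Z n) x) - 2 * al * x.

Definition limit_curv (R : realType) (al : R) (Z : nat -> seq R) (x : R) : R :=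
  2 * al + limn (fun n => sum_inv2 (Z n) x).

Section GaussLimit.
Variables (R : realType) (f : R -> R) (al : R) (C be : nat -> R).
Variable Z : nat -> seq R.
Hypothesis fZ : gauss_limit f al C be Z.

Let off x := forall n, x \notin Z n.
Let S := limit_logder al be Z.
Let Q x := limn (fun n => sum_inv2 (Z n) x).
Let F n := gauss_poly al (C n) (be n) (Z n).
Let Sn n x := be n + sum_inv (Z n) x - 2 * al * x.

Lemma off_neq x n r : off x -> r \in Z n -> x != r.
Proof. by move=> ox rZ; apply/eqP => xr; move: (ox n); rewrite xr rZ. Qed.

Lemma cvg_Sn x : off x -> Sn n x @[n --> \oo] --> S x.
Proof. by move=> ox; apply: cvgB; [exact: gl_inv fZ _ ox | exact: cvg_cst]. Qed.

Lemma cvg_sum_inv2 x : off x -> sum_inv2 (Z n) x @[n --> \oo] --> Q x.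
Proof. by move=> ox; exact: gl_inv2 fZ _ ox. Qed.

Lemma sum_inv2_le_lim x n : off x -> sum_inv2 (Z n) x <= Q x.
Proof.
move=> ox; apply: (@nondecreasing_cvgn_le R (fun n => sum_inv2 (Z n) x));
  last exact: gl_inv2 fZ _ ox.
move=> m k /(gl_prefix fZ) /prefixP[s ->].
by rewrite /sum_inv2 big_cat lerDl; exact: sum_inv2_ge0.
Qed.

(** The zeros cannot accumulate at x, since each of them contributes
    (x - r)^-2 to a convergent sum. *)
Lemma zeros_gap x : off x ->
  exists2 e : R, 0 < e & forall n r, r \in Z n -> e <= `|x - r|.
Proof.
move=> ox; have Q0 : 0 <= Q x.
  by apply: le_trans (sum_inv2_le_lim 0 ox); exact: sum_inv2_ge0.
exists (Q x + 1)^-1 => [|n r rZ]; first by rewrite invr_gt0; lra.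
have d0 : 0 < `|x - r| by rewrite normr_gt0 subr_eq0 (off_neq ox rZ).
rewrite -[leRHS]invrK lef_pV2 ?posrE ?invr_gt0//; last lra.
set y := _^-1; have : y ^+ 2 <= Q x.
  apply: le_trans (sum_inv2_le_lim n ox).
  rewrite /sum_inv2 (big_rem r)//= /y -normfV -normrX ger0_norm ?sqr_ge0//.
  by rewrite exprVn lerDl; exact: sum_inv2_ge0.
by have := sqr_ge0 (y - 1); nra.
Qed.

Lemma limit_shift_bound x : off x ->
  exists e K, 0 < e /\ forall h, `|h| <= e ->
    `|f (x + h) - f x - h * (f x * S x)| <= `|f x| * (K * h ^+ 2).
Proof.
move=> ox; have [d d0 dZ] := zeros_gap ox.
set M := `|S x| + 1; have M0 : 0 < M by rewrite /M; have := normr_ge0 (S x); lra.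
exists (Num.min (d / 2) (2 * M)^-1), (2 * M ^+ 2 + al + 2 * Q x).
split; first by rewrite lt_min divr_gt0// invr_gt0 mulr_gt0.
move=> h; rewrite le_min => /andP[h1 h2].
have H1 : `|F n (x + h) - F n x - h * (F n x * Sn n x)| @[n --> \oo] -->
    `|f (x + h) - f x - h * (f x * S x)|.
  apply: cvg_norm; apply: cvgB.
    by apply: cvgB; exact: gl_cvg fZ _.
  apply: cvgM; first exact: cvg_cst.
  by apply: cvgM; [exact: gl_cvg fZ _ | exact: cvg_Sn].
have H2 : `|F n x| * ((2 * M ^+ 2 + al + 2 * Q x) * h ^+ 2) @[n --> \oo] -->
    `|f x| * ((2 * M ^+ 2 + al + 2 * Q x) * h ^+ 2).
  by apply: cvgM; [apply: cvg_norm; exact: gl_cvg fZ _ | exact: cvg_cst].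
apply: (ler_cvg_to H1 H2).
have : \forall n \near \oo, `|Sn n x| <= M.
  have /cvgr_dist_le/(_ 1 ltr01) := cvg_Sn ox.
  apply: filterS => n /=; rewrite distrC => H.
  have := ler_normD (Sn n x - S x) (S x); rewrite subrK => /le_trans; apply.
  by rewrite /M addrC lerD2l.
apply: filterS => n SM.
have := @gauss_poly_shift_bound R al (C n) (be n) (Z n) x h (gl_ge0 fZ).
move=> /(_ (fun r => @off_neq x n r ox)) /= H.
apply: le_trans (H _ _) _.
- by move=> r rZ; apply: le_trans (dZ _ _ rZ); rewrite mulrC -ler_pdivlMr.
- rewrite normrM mulrA; apply: le_trans (_ : 2 * (2 * M)^-1 * M <= _).
    by apply: ler_pM => //; rewrite ?mulr_ge0// ler_wpM2l.
  by rewrite le_eqVlt; apply/orP; left; apply/eqP; field; rewrite gt_eqF.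
- apply: ler_wpM2l => //; apply: ler_wpM2r; first exact: sqr_ge0.
  rewrite lerD// ?lerD2r ?ler_wpM2l// ?sum_inv2_le_lim//.
  by rewrite -[leLHS]ger0_norm ?sqr_ge0// normrX; apply: lerXn2r; rewrite ?nnegrE// ltW.
Qed.

Lemma limit_is_derive x : off x -> is_derive x 1 f (f x * S x).
Proof.
move=> /limit_shift_bound[e [K [e0 H]]].
by apply: (is_derive_quadratic (e := e) (K := `|f x| * K)) => // h /H Hh; rewrite -[leRHS]mulrA.
Qed.

(** A zero of f that is not a zero of any factor makes f vanish identically
    nearby: the error in [limit_shift_bound] is relative to f x. *)
Lemma limit_zero_near x : off x -> f x = 0 ->
  exists2 e, 0 < e & forall h, `|h| <= e -> f (x + h) = 0.
Proof.
move=> /limit_shift_bound[e [K [e0 H]]] fx0; exists e => // h /H.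
by rewrite fx0 !mul0r mulr0 normr0 mul0r !subr0 normr_le0 => /eqP.
Qed.

Lemma off_shift x e h : (forall n r, r \in Z n -> e <= `|x - r|) -> `|h| < e ->
  off (x + h).
Proof.
move=> H he n; apply/negP => /H; rewrite opprD addrA subrr add0r normrN.
by rewrite leNgt he.
Qed.

(** Termwise, the error of the linear approximation of 1/(x - r) is exactly
    h^2 / ((x + h - r) (x - r)^2), and the gap around x bounds the first factor
    of the denominator below by d / 2. *)
Lemma limit_logder_is_derive x : off x -> is_derive x 1 S (- limit_curv al Z x).
Proof.
move=> ox; have [d d0 dZ] := zeros_gap ox.
apply: (is_derive_quadratic (e := d / 2) (K := 2 / d * Q x)); first exact: divr_gt0.
move=> h hd.
have ohx : off (x + h) by apply: off_shift dZ _; lra.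
have H1 : `|Sn n (x + h) - Sn n x - h * - (2 * al + sum_inv2 (Z n) x)| @[n --> \oo]
   --> `|S (x + h) - S x - h * - (2 * al + Q x)|.
  apply: cvg_norm; apply: cvgB; first by apply: cvgB; exact: cvg_Sn.
  apply: cvgM; first exact: cvg_cst.
  by apply: cvgN; apply: cvgD; [exact: cvg_cst | exact: cvg_sum_inv2].
have H2 : 2 / d * sum_inv2 (Z n) x * h ^+ 2 @[n --> \oo] --> 2 / d * Q x * h ^+ 2.
  apply: cvgM; last exact: cvg_cst.
  by apply: cvgM; [exact: cvg_cst | exact: cvg_sum_inv2].
apply: (ler_cvg_to H1 H2); apply: nearW => n.
have -> : Sn n (x + h) - Sn n x - h * - (2 * al + sum_inv2 (Z n) x) =
   sum_inv (Z n) (x + h) - sum_inv (Z n) x + h * sum_inv2 (Z n) x by rewrite /Sn; ring.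
rewrite /sum_inv /sum_inv2 mulr_sumr -sumrB -big_split /= mulr_sumr mulr_suml.
apply: le_trans (ler_norm_sum _ _ _) _.
rewrite 2!big_seq; apply: ler_sum => r rZ.
have xr : x - r != 0 by rewrite subr_eq0 (off_neq ox rZ).
have xhr : x + h - r != 0 by rewrite subr_eq0 (off_neq ohx rZ).
have -> : (x + h - r)^-1 - (x - r)^-1 + h * (x - r) ^- 2 =
   (x + h - r)^-1 * (x - r) ^- 2 * h ^+ 2.
  by field; rewrite xr xhr.
rewrite 2!normrM [`|h ^+ 2|]ger0_norm ?sqr_ge0//.
rewrite [`|(x - r) ^- 2|]ger0_norm ?invr_ge0 ?sqr_ge0//.
apply: ler_wpM2r; rewrite ?sqr_ge0//; apply: ler_wpM2r; rewrite ?invr_ge0 ?sqr_ge0//.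
rewrite normfV -[2 / d]invrK lef_pV2 ?posrE ?invr_gt0 ?divr_gt0 ?normr_gt0// invf_div.
have := dZ _ _ rZ; have := ler_normB (x + h - r) h.
have -> : x + h - r - h = x - r by ring.
by lra.
Qed.

Lemma neq0_off x : f x != 0 -> off x.
Proof.
move=> fx0 N; apply: contra_neqN fx0 => xN.
have : F n x @[n --> \oo] --> (0 : R).
  apply/cvgrPdist_le => e e0; exists N => // n /= Nn.
  have /prefixP[s Zs] := gl_prefix fZ Nn.
  rewrite /F /gauss_poly Zs big_cat /= (big_rem x)//= subrr !(mul0r, mulr0).
  by rewrite subrr normr0 ltW.
by move=> F0; rewrite -(cvg_lim (@Rhausdorff R) F0); apply/esym/(cvg_lim (@Rhausdorff R)); exact: gl_cvg fZ _.
Qed.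

Lemma limit_derive1 x : off x -> derive1 f x = f x * S x.
Proof. by move=> ox; rewrite derive1E; have [_ ->] := limit_is_derive ox. Qed.

Lemma limit_derive1n2 x : off x ->
  derive1n 2 f x = f x * (S x ^+ 2 - limit_curv al Z x).
Proof.
move=> ox; have [d d0 dZ] := zeros_gap ox.
have -> : derive1n 2 f x = derive1 (derive1 f) x by [].
rewrite derive1E.
rewrite (@near_eq_derive _ _ _ _ (f * S)); last first.
  near=> y; rewrite limit_derive1//.
  rewrite -(subrK x y) addrC; apply: (off_shift dZ).
  by rewrite distrC; near: y; exact: cvgr_dist_lt.
have [_ ->] := is_deriveM (limit_is_derive ox) (limit_logder_is_derive ox).
by rewrite /GRing.scale /=; ring.
Unshelve. all: by end_near. Qed.

(** Substituting f' = f S, f'' = f (S^2 - curvature) and a = S in the equation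
    leaves f (b - S^2 - curvature) = 0. *)
Lemma discr_limit_curv (D : set R) (a b : R -> R) c :
  solves_ode D a b f -> D c -> f c != 0 -> a c = logder f c ->
  discr a b c = limit_curv al Z c.
Proof.
move=> ode Dc fc0 ac; have oc := neq0_off fc0; have := ode c Dc.
have aS : a c = S c by rewrite ac /logder limit_derive1// mulrC mulKf.
rewrite limit_derive1n2// limit_derive1// /discr aS => E.
apply/eqP; rewrite -subr_eq0 -(mulrI_eq0 _ (mulfI fc0)) -E; apply/eqP; ring.
Qed.
End GaussLimit.

(** * Zeros and curvature *)

Section Curvature.
Variables (R : realType) (f : R -> R) (al : R) (C be : nat -> R).
Variable Z : nat -> seq R.
Hypothesis fZ : gauss_limit f al C be Z.

Lemma endpoint_mem_zeros z :
  f z = 0 -> (forall e, 0 < e -> exists2 h, `|h| <= e & f (z + h) != 0) ->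
  exists n, z \in Z n.
Proof.
move=> fz0 zlim; apply: contrapT => zZ.
have oz : forall n, z \notin Z n by move=> n; apply/negP => zn; apply: zZ; exists n.
have [e e0 He] := limit_zero_near fZ oz fz0.
by have [h /He ->] := zlim e e0; rewrite eqxx.
Qed.

Lemma limit_curv_gt0 x : (forall n, x \notin Z n) ->
  0 < al \/ (exists n, (1 < size (Z n))%N) -> 0 < limit_curv al Z x.
Proof.
move=> ox; have a0 := gl_ge0 fZ; rewrite /limit_curv => -[al0|[n sn]].
  by have := sum_inv2_le_lim fZ 0 ox; have := sum_inv2_ge0 (Z 0) x; lra.
have := sum_inv2_le_lim fZ n ox.
by have := sum_inv2_gt0 (ox n) (ltnW sn); lra.
Qed.

(** Strictness: either the Gaussian factor or a second zero adds a positive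
    amount to the contribution of z. *)
Lemma limit_curv_gt x z n : (forall n, x \notin Z n) -> z \in Z n ->
  0 < al \/ (exists n, (1 < size (Z n))%N) -> (x - z) ^- 2 < limit_curv al Z x.
Proof.
move=> ox zn; have a0 := gl_ge0 fZ; rewrite /limit_curv => -[al0|[k sk]].
  have := sum_inv2_le_lim fZ n ox; rewrite {1}/sum_inv2 (big_rem z)//=.
  by have := sum_inv2_ge0 (rem z (Z n)) x; rewrite /sum_inv2; lra.
(* A single list that contains z and has at least two entries. *)
pose m := maxn n k.
have zm : z \in Z m.
  by have /prefixP[s ->] := gl_prefix fZ (leq_maxl n k); rewrite mem_cat zn.
have sm : (1 < size (Z m))%N.
  have /prefixP[s ->] := gl_prefix fZ (leq_maxr n k).
  by rewrite size_cat (leq_trans sk)// leq_addr.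
have rm : 0 < sum_inv2 (rem z (Z m)) x.
  apply: sum_inv2_gt0; last by rewrite size_rem//; case: (size _) sm => // -[].
  by apply: contra (ox m); exact: mem_rem.
have := sum_inv2_le_lim fZ m ox; rewrite {1}/sum_inv2 (big_rem z)//=.
by move: rm; rewrite /sum_inv2; lra.
Qed.

Lemma zeros_stabilize : (forall n, size (Z n) <= 1)%N ->
  exists N s, (size s <= 1)%N /\ forall n, (N <= n)%N -> Z n = s.
Proof.
move=> Z1; have [[N ZN]|Z0] := pselect (exists N, Z N != [::]); last first.
  exists 0%N, [::]; split => // n _; apply/eqP; apply: contrapT => /negP ?.
  by apply: Z0; exists n.
exists N, (Z N); split => // n Nn.
have /prefixP[[|r s] Zn] := gl_prefix fZ Nn; first by rewrite Zn cats0.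
move: (Z1 n); rewrite Zn size_cat; case: (Z N) ZN => // r' s' _ /=.
by rewrite addnS.
Qed.

(** With at most one zero and no Gaussian factor, normalizing at a point c where
    f does not vanish eliminates the constants C_n:
    F_n(x) = F_n(c) exp (be_n (x - c)) P(x) / P(c) with P fixed for large n, and
    be_n converges because be_n + sum_inv (Z_n) c does. *)
Lemma affine_times_exp_of_one_zero c : f c != 0 -> al = 0 ->
  (forall n, size (Z n) <= 1)%N -> affine_times_exp f.
Proof.
move=> fc0 al0 Z1; have oc := neq0_off fZ fc0.
have [N [s [s1 Zs]]] := zeros_stabilize Z1.
pose P x := \prod_(r <- s) (x - r).
have Pc : P c != 0.
  rewrite /P prodf_seq_neq0; apply/allP => r rs /=; rewrite subr_eq0.
  by apply: (off_neq oc (n := N)); rewrite Zs.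
have [p [q Ppq]] : exists p q, forall x, P x = p * x + q.
  rewrite /P; case: s s1 {Zs P Pc} => [|r [|//]] _.
    by exists 0, 1 => x; rewrite big_nil mul0r add0r.
  by exists 1, (- r) => x; rewrite big_seq1 mul1r.
have [B beB] : exists B : R, be n @[n --> \oo] --> B.
  have H : (be n + sum_inv (Z n) c) - sum_inv s c @[n --> \oo] -->
     limn (fun n => be n + sum_inv (Z n) c) - sum_inv s c.
    by apply: cvgB; [exact: gl_inv fZ _ oc | exact: cvg_cst].
  exists (limn (fun n => be n + sum_inv (Z n) c) - sum_inv s c).
  apply: cvg_trans H; apply: near_eq_cvg; exists N => // n /= Nn.
  by rewrite Zs// addrK.
have fx x : f x = f c / P c * expR (B * (x - c)) * P x.
  have H : gauss_poly al (C n) (be n) (Z n) c / P c * expR (be n * (x - c)) * P x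
      @[n --> \oo] --> f c / P c * expR (B * (x - c)) * P x.
    apply: cvgM; last exact: cvg_cst.
    apply: cvgM; first by apply: cvgM; [exact: gl_cvg fZ _ | exact: cvg_cst].
    apply: (continuous_cvg _ (@continuous_expR R _)).
    by apply: cvgM => //; exact: cvg_cst.
  have H' : gauss_poly al (C n) (be n) (Z n) x
      @[n --> \oo] --> f c / P c * expR (B * (x - c)) * P x.
    apply: cvg_trans H; apply: near_eq_cvg; exists N => // n /= Nn.
    rewrite /gauss_poly Zs// al0 -!/(P _) !oppr0 !mul0r !add0r.
    rewrite (mulfK Pc) -[X in X * P x = _]mulrA -expRD.
    by congr (_ * expR _ * _); ring.
  rewrite -(cvg_lim (@Rhausdorff R) H'); apply/esym/(cvg_lim (@Rhausdorff R)).
  exact: gl_cvg fZ _.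
pose k := f c / P c * expR (- B * c).
exists (k * p), (k * q), B => x.
rewrite fx (Ppq x) mulrBr expRD /k mulNr; ring.
Qed.

End Curvature.

(** * The Laguerre-Polya class *)

Lemma cvg_filtered_sum (R : realType) (I : pred nat) (u v : nat -> R) (M : R) :
  0 <= M -> (forall i, 0 <= v i) -> (forall i, I i -> `|u i| <= M * v i) ->
  cvgn (fun n => \sum_(0 <= i < n | I i) v i) ->
  cvgn (fun n => \sum_(0 <= i < n | I i) u i).
Proof.
move=> M0 v0 uv vcvg.
have -> : (fun n => \sum_(0 <= i < n | I i) u i) =
    series (fun i => if I i then u i else 0).
  by apply/funext => n; rewrite /series /= big_mkcond.
apply: normed_cvg.
apply: (@series_le_cvg R _ (fun i => M * (if I i then v i else 0))).
- by move=> n; exact: normr_ge0.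
- by move=> n; case: ifP => _; rewrite mulr_ge0.
- by move=> n /=; case: ifP => [/uv//|_]; rewrite normr0 mulr0.
have -> : series (fun i => M * (if I i then v i else 0)) =
    (fun n => M * \sum_(0 <= i < n | I i) v i).
  by apply/funext => n; rewrite /series /= -mulr_sumr -big_mkcond.
by apply: is_cvgM => //; exact: is_cvg_cst.
Qed.

(** Compares the sums over 1/(x - z_i)^2 and 1/(x - z_i) + 1/z_i with the sum of
    the z_i^-2.  For all but finitely many i, |z_i| > 2 (|x| + 1), whence
    |x - z_i| >= |z_i| / 2 and the constant 2 works; the others are covered by
    adding up their finitely many ratios. *)
Lemma zero_ratio_bounded (R : realType) (I : pred nat) (z : nat -> R) (x : R) :
  (forall i, I i -> z i != 0) -> (forall i, I i -> x != z i) ->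
  cvgn (fun n => \sum_(0 <= i < n | I i) (z i) ^- 2) ->
  exists2 K, 0 <= K & forall i, I i -> `|z i| <= K * `|x - z i|.
Proof.
move=> z0 xz zcvg.
have /cvgrPdist_lt/(_ ((2 * (`|x| + 1)) ^- 2)) :
    (fun i => if I i then z i ^- 2 else 0) @ \oo --> (0 : R).
  apply: cvg_series_cvg_0; move: zcvg.
  by congr (cvgn _); apply/funext => n; rewrite /series /= big_mkcond.
have x1 : 0 < `|x| + 1 by have := normr_ge0 x; lra.
case=> [|N _ HN]; first by rewrite invr_gt0 exprn_gt0// mulr_gt0.
pose K := \sum_(0 <= i < N) `|z i| / `|x - z i|.
have K0 : 0 <= K by apply: sumr_ge0 => i _; rewrite divr_ge0.
exists (K + 2); first lra.
move=> i Ii; have d0 : 0 < `|x - z i| by rewrite normr_gt0 subr_eq0 xz.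
have [Ni|iN] := leqP N i; last first.
  rewrite -ler_pdivrMr// /K (big_rem i) ?mem_index_iota//=.
  rewrite -addrA lerDl addr_ge0//.
  by apply: sumr_ge0 => j _; rewrite divr_ge0.
have := HN i Ni; rewrite /= Ii sub0r normrN normfV normrX => H.
have zi0 : 0 < `|z i| by rewrite normr_gt0 z0.
have {H} : 2 * (`|x| + 1) < `|z i|.
  move: H; rewrite ltf_pV2 ?posrE ?exprn_gt0 ?mulr_gt0//.
  by rewrite ltr_pXn2r ?nnegrE// ?mulr_ge0// ltW.
have := ler_normB x (x - z i); rewrite opprB addrC subrK => ? ?.
have : 0 <= K * `|x - z i| by rewrite mulr_ge0.
by rewrite mulrDl; lra.
Qed.

Section Hadamard.
Variables (R : realType) (c al be : R) (m : nat) (I : pred nat) (z : nat -> R).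
Hypothesis (al0 : 0 <= al) (z0 : forall i, I i -> z i != 0).
Hypothesis zcvg : cvgn (fun n => \sum_(0 <= i < n | I i) (z i) ^- 2).

Definition hadamard_zeros n := nseq m 0 ++ [seq z i | i <- index_iota 0 n & I i].
(* 1 - x / z = - z^-1 * (x - z). *)
Definition hadamard_coef n := c * \prod_(0 <= i < n | I i) - (z i)^-1.
Definition hadamard_slope n := be + \sum_(0 <= i < n | I i) (z i)^-1.

Lemma hadamard_factors n x :
  c * x ^+ m * expR (- al * x ^+ 2 + be * x) *
     \prod_(0 <= i < n | I i) ((1 - x / z i) * expR (x / z i))
  = gauss_poly al (hadamard_coef n) (hadamard_slope n) (hadamard_zeros n) x.
Proof.
rewrite /gauss_poly /hadamard_coef /hadamard_slope /hadamard_zeros.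
rewrite big_cat /= big_map big_filter.
have -> : \prod_(r <- nseq m 0) (x - r) = x ^+ m.
  by rewrite big_nseq subr0 -Monoid.iteropE.
have -> : \prod_(0 <= i < n | I i) ((1 - x / z i) * expR (x / z i)) =
    \prod_(0 <= i < n | I i) (- (z i)^-1) * \prod_(0 <= i < n | I i) (x - z i)
    * expR (x * \sum_(0 <= i < n | I i) (z i)^-1).
  rewrite mulr_sumr expR_sum -!big_split /=; apply: eq_bigr => i Ii.
  by congr (_ * _); have := z0 Ii => ?; field.
rewrite mulrDl addrA !expRD [x * \sum_(_ <= _ < _ | _) _]mulrC; ring.
Qed.

Lemma gauss_limit_hadamard (f : R -> R) :
  (forall x : R, (fun n : nat => c * x ^+ m * expR (- al * x ^+ 2 + be * x) *
     \prod_(0 <= i < n | I i) ((1 - x / z i) * expR (x / z i)))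
          @ \oo --> f x) ->
  gauss_limit f al hadamard_coef hadamard_slope hadamard_zeros.
Proof.
move=> fcvg.
have xz x : (forall n, x \notin hadamard_zeros n) -> forall i, I i -> x != z i.
  move=> ox i Ii; apply: contraNneq (ox i.+1) => ->.
  rewrite mem_cat; apply/orP; right; apply/map_f.
  by rewrite mem_filter Ii mem_index_iota /=.
split => //.
- move=> n k nk; apply/prefixP; exists [seq z i | i <- index_iota n k & I i].
  by rewrite /hadamard_zeros -catA -map_cat -filter_cat /index_iota !subn0 -iotaD subnKC.
- move=> x; apply: cvg_trans (fcvg x); apply: near_eq_cvg; apply: nearW => n.
  by rewrite hadamard_factors.
- move=> x ox.
  have [K K0 HK] := zero_ratio_bounded z0 (xz x ox) zcvg.
  have -> : (fun n => hadamard_slope n + sum_inv (hadamard_zeros n) x) =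
      (fun n => be + sum_inv (nseq m 0) x
          + \sum_(0 <= i < n | I i) ((z i)^-1 + (x - z i)^-1)).
    apply/funext => n; rewrite /hadamard_slope /hadamard_zeros /sum_inv.
    rewrite big_cat /= big_map big_filter big_split /=; ring.
  apply: is_cvgD; first exact: is_cvg_cst.
  apply: (@cvg_filtered_sum _ _ _ (fun i => z i ^- 2) (`|x| * K)) => //.
  + by rewrite mulr_ge0.
  + by move=> i; rewrite invr_ge0 sqr_ge0.
  move=> i Ii; have zi := z0 Ii; have xzi := xz x ox i Ii.
  have xzi0 : x - z i != 0 by rewrite subr_eq0.
  have -> : (z i)^-1 + (x - z i)^-1 = x * z i ^- 2 * (z i / (x - z i)).
    by field; rewrite zi xzi0.
  rewrite 2!normrM [`|_ ^- 2|]ger0_norm ?invr_ge0 ?sqr_ge0//.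
  rewrite [leRHS]mulrAC ler_wpM2l ?mulr_ge0 ?invr_ge0 ?sqr_ge0//.
  by rewrite normrM normfV ler_pdivrMr ?normr_gt0 ?HK.
- move=> x ox.
  have [K K0 HK] := zero_ratio_bounded z0 (xz x ox) zcvg.
  have -> : (fun n => sum_inv2 (hadamard_zeros n) x) =
      (fun n => sum_inv2 (nseq m 0) x + \sum_(0 <= i < n | I i) (x - z i) ^- 2).
    apply/funext => n; rewrite /hadamard_zeros /sum_inv2.
    by rewrite big_cat /= big_map big_filter.
  apply: is_cvgD; first exact: is_cvg_cst.
  apply: (@cvg_filtered_sum _ _ _ (fun i => z i ^- 2) (K ^+ 2)) => //.
  + by rewrite sqr_ge0.
  + by move=> i; rewrite invr_ge0 sqr_ge0.
  move=> i Ii; have zi := z0 Ii; have xzi := xz x ox i Ii.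
  have xzi0 : x - z i != 0 by rewrite subr_eq0.
  rewrite ger0_norm ?invr_ge0 ?sqr_ge0//.
  rewrite ler_pdivlMr ?exprn_even_gt0//= mulrC ler_pdivrMr ?exprn_even_gt0//=.
  rewrite -exprMn -[leLHS]ger0_norm ?sqr_ge0// -[leRHS]ger0_norm ?sqr_ge0//.
  rewrite !normrX lerXn2r ?nnegrE//.
  by rewrite normrM (ger0_norm K0) HK.
Qed.

End Hadamard.

(** Factor over the complex numbers; the roots are real, and a field embedding is
    injective on polynomials. *)
Lemma real_rooted_split (R : realType) (p : {poly R}) : real_rooted p ->
  exists s : seq R, p = lead_coef p *: \prod_(r <- s) ('X - r%:P).
Proof.
move=> pr; have [w pw] := closed_field_poly_normal (map_poly (real_complex R) p).
have [->|p0] := eqVneq p 0; first by exists [::]; rewrite lead_coef0 scale0r.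
exists (map (@complex.Re R) w); apply: (@map_poly_inj _ _ (real_complex R)).
rewrite pw lead_coef_map map_polyZ /= rmorph_prod big_map; congr (_ *: _).
rewrite 2!big_seq; apply: eq_bigr => v vw.
rewrite rmorphB /= map_polyX map_polyC /=; congr (_ - _%:P).
have : complex.Im v = 0.
  apply: pr; rewrite pw rootZ ?lead_coef_eq0 ?map_poly_eq0//.
  by rewrite root_prod_XsubC.
by case: v {vw} => a b /= ->.
Qed.

Lemma gauss_limit_of_laguerre_polya (R : realType) (f : R -> R) :
  laguerre_polya f -> exists al C be Z, gauss_limit f al C be Z.
Proof.
case=> [[p /real_rooted_split[s ps] fp] | ].
  exists 0, (fun=> lead_coef p), (fun=> 0), (fun=> s); split => //.
  - by move=> n k _; exact: prefix_refl.
  - move=> x; have -> : gauss_poly 0 (lead_coef p) 0 s x = f x.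
      rewrite fp [in RHS]ps hornerZ horner_prod /gauss_poly.
      rewrite oppr0 !mul0r addr0 expR0 mulr1; congr (_ * _).
      by apply: eq_bigr => r _; rewrite hornerXsubC.
    exact: cvg_cst.
  - by move=> x _; exact: is_cvg_cst.
  - by move=> x _; exact: is_cvg_cst.
move=> [c [al [be [m [I [z [al0 z0 zcvg fcvg]]]]]]].
exists al, (hadamard_coef c I z), (hadamard_slope be I z), (hadamard_zeros m I z).
exact: gauss_limit_hadamard.
Qed.

Theorem theorem1 (R : realType) (f : R -> R) (D : set R) (a b : R -> R)
    (f_LP : laguerre_polya f) (f_neq0 : exists x, f x != 0)
    (f_nondeg : ~ affine_times_exp f)
    (f_ode : solves_ode D a b f) :
  (forall (l r : \bar R) (c : R), meets_branch D a f l r c ->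
     [/\ regionJ D a b c,
         (l < (c - (Num.sqrt (discr a b c))^-1)%:E)%E &
         ((c + (Num.sqrt (discr a b c))^-1)%:E < r)%E])
  /\
  (forall x1 : R, f x1 = 0 ->
     (exists c, meets_branch D a f -oo%E x1%:E c) ->
     (ereal_inf [set (x + (Num.sqrt (discr a b x))^-1)%:E
                | x in regionJ D a b] < x1%:E)%E)
  /\
  (forall xk : R, f xk = 0 ->
     (exists c, meets_branch D a f xk%:E +oo%E c) ->
     (xk%:E < ereal_sup [set (x - (Num.sqrt (discr a b x))^-1)%:E
                        | x in regionJ D a b])%E).
Proof.
have [al [C [be [Z fZ]]]] := gauss_limit_of_laguerre_polya f_LP.
have nondeg : 0 < al \/ (exists n, (1 < size (Z n))%N).
  have [?|al0] := ltP 0 al; first by left.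
  right; apply: contrapT => H; apply: f_nondeg.
  have [c fc0] := f_neq0; apply: (affine_times_exp_of_one_zero fZ fc0).
    by apply/eqP; rewrite eq_le al0 (gl_ge0 fZ).
  by move=> n; rewrite leqNgt; apply/negP => ?; apply: H; exists n.
have bounds (l r : \bar R) (c : R) : meets_branch D a f l r c ->
     [/\ regionJ D a b c,
         (l < (c - (Num.sqrt (discr a b c))^-1)%:E)%E &
         ((c + (Num.sqrt (discr a b c))^-1)%:E < r)%E].
  move=> [[lP rP lr nz] lc cr Dc ac].
  have fc0 := nz c lc cr; have oc := neq0_off fZ fc0.
  rewrite (discr_limit_curv fZ f_ode Dc fc0 ac).
  have d0 := limit_curv_gt0 fZ oc nondeg.
  have far z n : z \in Z n -> (Num.sqrt (limit_curv al Z c))^-1 < `|c - z|.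
    move=> zn; have H := limit_curv_gt fZ oc zn nondeg.
    have cz : 0 < `|c - z| by rewrite normr_gt0 subr_eq0 (off_neq oc zn).
    rewrite -[ltRHS]invrK ltf_pV2 ?posrE ?sqrtr_gt0 ?invr_gt0//.
    rewrite -[ltLHS]ger0_norm ?invr_ge0// -sqrtr_sqr ltr_sqrt//.
    by rewrite exprVn real_normK ?num_real.
  split.
  - by split => //; rewrite (discr_limit_curv fZ f_ode Dc fc0 ac).
  - case: lP => [->|[z lz fz0]]; first exact: ltNyr.
    move: lc lr nz; rewrite lz lte_fin => zc _ nz.
    have [n zn] : exists n, z \in Z n.
      (* Points between z and c are in the branch, so f is nonzero there. *)
      apply: (endpoint_mem_zeros fZ fz0) => e e0.
      exists (Num.min e (c - z)).
        by rewrite ger0_norm ?ge_min ?lexx// le_min; lra.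
      have ? : 0 < Num.min e (c - z) by rewrite lt_min e0 subr_gt0.
      apply: nz; first by rewrite lte_fin; lra.
      apply: le_lt_trans cr; rewrite lee_fin -lerBrDl.
      by rewrite ge_min lexx orbT.
    have := far z n zn; rewrite gtr0_norm ?subr_gt0// lte_fin; lra.
  - case: rP => [->|[z rz fz0]]; first exact: ltry.
    move: cr lr nz; rewrite rz lte_fin => zc _ nz.
    have [n zn] : exists n, z \in Z n.
      apply: (endpoint_mem_zeros fZ fz0) => e e0.
      exists (- Num.min e (z - c)).
        by rewrite normrN ger0_norm ?ge_min ?lexx// le_min; lra.
      have ? : 0 < Num.min e (z - c) by rewrite lt_min e0 subr_gt0.
      apply: nz; last by rewrite lte_fin; lra.
      apply: lt_le_trans lc _; rewrite lee_fin lerBrDr -lerBrDl.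
      by rewrite ge_min lexx orbT.
    have := far z n zn; rewrite distrC gtr0_norm ?subr_gt0// lte_fin; lra.
split=> //; split.
- move=> x1 _ [c /bounds[Jc _ H]]; apply: le_lt_trans H.
  by apply: ereal_inf_lbound; exists c.
- move=> xk _ [c /bounds[Jc H _]]; apply: lt_le_trans H _.
  by apply: ereal_sup_ubound; exists c.
Qed.
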